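(* Let $T\colon\mathsf{Set}\to\mathsf{Set}$ be a functor, let $L$ be a finitarily separable fuzzy lax extension of $T$, and let $\Lambda$ be a separating set of monotone nonexpansive predicate liftings for $L$. Then $d^\Lambda=d^L$, i.e. for all $T$-coalgebras $\alpha\colon A\to TA$, $\beta\colon B\to TB$ and all $a\in A$, $b\in B$, the $\Lambda$-logical distance $d^\Lambda(a,b)$ equals the $L$-behavioural distance $d^L_{\alpha,\beta}(a,b)$.
   Context: A fuzzy relation between sets $A$ and $B$ is a map $R\colon A\times B\to[0,1]$; fuzzy relations are ordered pointwise, and the converse is $R^\circ(b,a)=R(a,b)$. For $x,y\in[0,1]$: $x\oplus y=\min(x+y,1)$, $x\ominus y=\max(x-y,0)$. Composition: $(R;S)(a,c)=\inf_{b\in B}R(a,b)\oplus S(b,c)$ (infima and suprema are taken in $[0,1]$). For $f\colon A\to B$, $\mathrm{Gr}_f(a,b)=0$ if $f(a)=b$ and $1$ otherwise; $\Delta_A=\mathrm{Gr}_{\mathrm{id}_A}$. A fuzzy lax extension $L$ of $T$ assigns to each fuzzy relation $R$ between $A$ and $B$ (for all sets $A,B$) a fuzzy relation $LR$ between $TA$ and $TB$ such that (L1) $R_1\le R_2$ implies $LR_1\le LR_2$; (L2) $L(R;S)\le LR;LS$; (L3) $L\,\mathrm{Gr}_f\le\mathrm{Gr}_{Tf}$ and $L(\mathrm{Gr}_f^\circ)\le\mathrm{Gr}_{Tf}^\circ$ for every function $f$. $T_\omega X=\bigcup\{Ti[TY]\mid Y\subseteq X\text{ finite}, i\colon Y\to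 X\text{ inclusion}\}\subseteq TX$. $L$ is finitarily separable if for every set $X$, every $t\in TX$ and every $\epsilon>0$ there is $s\in T_\omega X$ with $L\Delta_X(t,s)\le\epsilon$ and $L\Delta_X(s,t)\le\epsilon$. Write $\mathcal{Q}X$ for the set of functions $X\to[0,1]$, a contravariant functor by precomposition. An $n$-ary (fuzzy) predicate lifting ($n\in\mathbb{N}$) is a natural transformation $\lambda\colon\mathcal{Q}^n\Rightarrow\mathcal{Q}\circ T$. It is monotone if, for all sets $X$ and all $f_i,g_i\in\mathcal{Q}X$, $f_i\le g_i$ for all $i$ implies $\lambda_X(f_1,\dots,f_n)\le\lambda_X(g_1,\dots,g_n)$; it is nonexpansive if $\|\lambda_X(f_1,\dots,f_n)-\lambda_X(g_1,\dots,g_n)\|_\infty\le\max_i\|f_i-g_i\|_\infty$ for all sets $X$ and all $f_i,g_i\in\mathcal{Q}X$. For a fuzzy relation $R$ between $A$ and $B$, a pair $(f,g)$ with $f\in\mathcal{Q}A$, $g\in\mathcal{Q}B$ is $R$-nonexpansive if $f(a)-g(b)\le R(a,b)$ for all $a\in A$, $b\in B$. The Kantorovich lifting $K_\Lambda$ is given by $$K_\Lambda R(t_1,t_2)=\sup\{\lambda_A(f_1,\dots,f_n)(t_1)\ominus\lambda_B(g_1,\dots,g_n)(t_2)\mid \lambda\in\Lambda\ n\text{-ary},\ (f_1,g_1),\dots,(f_n,g_n)\ R\text{-nonexpansive}\}$$ for $t_1\in TA$, $t_2\in TB$. The set $\Lambda$ is separating for $L$ if $K_\Lambda R\ge LR$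 for all fuzzy relations $R$. Behavioural distance: for coalgebras $\alpha\colon A\to TA$, $\beta\colon B\to TB$, an $L$-simulation is a fuzzy relation $R$ between $A$ and $B$ with $LR(\alpha(a),\beta(b))\le R(a,b)$ for all $a,b$; $d^L_{\alpha,\beta}$ is the pointwise infimum of all $L$-simulations between $A$ and $B$. Logic: the formulae $\mathcal{L}_\Lambda$ are given by the grammar $\phi,\psi::=c\mid\phi\ominus c\mid\phi\oplus c\mid\phi\land\psi\mid\phi\lor\psi\mid\lambda(\phi_1,\dots,\phi_n)$ with $c\in\mathbb{Q}\cap[0,1]$ and $\lambda\in\Lambda$ $n$-ary. In a coalgebra $(A,\alpha)$, $[\![\phi]\!]\colon A\to[0,1]$ is defined by interpreting $c$ as a constant, $\ominus c$ and $\oplus c$ as the truncated operations above, $\land$ and $\lor$ as pointwise minimum and maximum, and $[\![\lambda(\phi_1,\dots,\phi_n)]\!](a)=\lambda_A([\![\phi_1]\!],\dots,[\![\phi_n]\!])(\alpha(a))$. The $\Lambda$-logical distance between states $a\in A$, $b\in B$ of coalgebras $(A,\alpha)$, $(B,\beta)$ is $d^\Lambda(a,b)=\sup\{[\![\phi]\!](a)\ominus[\![\phi]\!](b)\mid\phi\in\mathcal{L}_\Lambda\}$ (evaluated in the respective coalgebras).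
   Formalization: The liftings in Λ are additionally required to be liftings ''for L'', sending R-nonexpansive pairs to LR-nonexpansive pairs (K_Λ R ≤ LR); without this the claim fails, e.g. T constant {0,1}, LR = 0, Λ the nullary inclusion lifting. *)

(* Defs.v *)
From mathcomp Require Import all_boot all_order all_algebra.
From mathcomp Require Import interval_inference.
From mathcomp Require Import all_classical all_reals.

Set Implicit Arguments.
Unset Strict Implicit.
Unset Printing Implicit Defensive.

Import Order.TTheory GRing.Theory Num.Theory.
Local Open Scope classical_set_scope.
Local Open Scope ring_scope.

(* A single fixed universe level of "sets": without it, the object part of a
   functor would get type Type@{u} -> Type@{v} with unrelated u and v. *)
Definition SET := Type.

Section UnitInterval.
Variable R : realType.
Implicit Types x y : {i01 R}.

Fact oplus_ge0 x y : 0 <= Num.min (x%:num + y%:num) 1.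
Proof. by rewrite le_min ler01 addr_ge0. Qed.

Fact oplus_le1 x y : Num.min (x%:num + y%:num) 1 <= 1.
Proof. by rewrite ge_min lexx orbT. Qed.

Definition oplus x y : {i01 R} := Itv01 (oplus_ge0 x y) (oplus_le1 x y).

Fact ominus_ge0 x y : 0 <= Num.max (x%:num - y%:num) 0.
Proof. by rewrite le_max lexx orbT. Qed.

Fact ominus_le1 x y : Num.max (x%:num - y%:num) 0 <= 1.
Proof.
by rewrite ge_max ler01 andbT lerBlDr (le_trans (y := 1)) // lerDl.
Qed.

Definition ominus x y : {i01 R} := Itv01 (ominus_ge0 x y) (ominus_le1 x y).

(* Suprema and infima are taken in the complete lattice [0,1], so that the
   supremum of the empty set is 0 (the library's convention [sup set0 = 0] on
   reals) and its infimum is 1 (hence the extra element 1 below). *)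
Fact supI_ge0 (S : set {i01 R}) : 0 <= sup [set x%:num | x in S].
Proof.
have [->|/set0P[x Sx]] := eqVneq S set0; first by rewrite image_set0 sup0.
apply: (le_trans (y := x%:num)) => //; apply: ub_le_sup; last by exists x.
by exists 1 => _ [y _ <-].
Qed.

Fact supI_le1 (S : set {i01 R}) : sup [set x%:num | x in S] <= 1.
Proof.
have [->|/set0P[x Sx]] := eqVneq S set0; first by rewrite image_set0 sup0.
by apply: ge_sup => [|_ [y _ <-]//]; exists x%:num, x.
Qed.

Definition supI (S : set {i01 R}) : {i01 R} := Itv01 (supI_ge0 S) (supI_le1 S).

Fact infI_ge0 (S : set {i01 R}) :
  0 <= inf ([set x%:num | x in S] `|` [set 1]).
Proof.
by apply: lb_le_inf => [|_ [[y _ <-]//|->//]]; exists 1; right.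
Qed.

Fact infI_le1 (S : set {i01 R}) :
  inf ([set x%:num | x in S] `|` [set 1]) <= 1.
Proof.
apply: ge_inf; last by right.
by exists 0 => _ [[y _ <-]//|->//].
Qed.

Definition infI (S : set {i01 R}) : {i01 R} := Itv01 (infI_ge0 S) (infI_le1 S).

Fact ratI_ge0 (c : {i01 rat}) : 0 <= ratr c%:num :> R.
Proof. by rewrite ler0q. Qed.

Fact ratI_le1 (c : {i01 rat}) : ratr c%:num <= 1 :> R.
Proof. by rewrite -(rmorph1 (@ratr R)) ler_rat. Qed.

Definition ratI (c : {i01 rat}) : {i01 R} := Itv01 (ratI_ge0 c) (ratI_le1 c).

End UnitInterval.

Section FuzzyRelations.
Variable R : realType.

Definition fuzzy_rel (A B : SET) := A -> B -> {i01 R}.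

Definition fuzzy_le (A B : SET) (r s : fuzzy_rel A B) : Prop :=
  forall a b, r a b <= s a b.

Definition fuzzy_conv (A B : SET) (r : fuzzy_rel A B) : fuzzy_rel B A :=
  fun b a => r a b.

Definition fuzzy_comp (A B C : SET) (r : fuzzy_rel A B) (s : fuzzy_rel B C) :
    fuzzy_rel A C :=
  fun a c => infI (range (fun b : B => oplus (r a b) (s b c))).

Definition graph (A B : SET) (f : A -> B) : fuzzy_rel A B :=
  fun a b => if `[< f a = b >] then 0%:i01 else 1%:i01.

Definition diag (A : SET) : fuzzy_rel A A := graph (@id A).

Definition nonexp_pair (A B : SET) (r : fuzzy_rel A B)
    (f : A -> {i01 R}) (g : B -> {i01 R}) : Prop :=
  forall a b, (f a)%:num - (g b)%:num <= (r a b)%:num.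

(* The supremum norm of f - g; it is 0 if X is empty. *)
Definition supdist (X : SET) (f g : X -> {i01 R}) : R :=
  sup (range (fun x : X => `|(f x)%:num - (g x)%:num|)).

End FuzzyRelations.

Arguments diag R A : clear implicits.

Record set_functor := SetFunctor {
  fobj :> SET -> SET;
  fmap : forall X Y : SET, (X -> Y) -> fobj X -> fobj Y;
  fmap_id : forall (X : SET) (t : fobj X), fmap id t = t;
  fmap_comp : forall (X Y Z : SET) (g : Y -> Z) (f : X -> Y) (t : fobj X),
    fmap (g \o f) t = fmap g (fmap f t) }.

Definition fin_part (T : set_functor) (X : SET) : set (T X) :=
  [set t | exists2 Y : set X, finite_set Y &
    range (fmap (@proj1_sig X (fun x => Y x))) t].

Record fuzzy_lax_extension (R : realType) (T : set_functor) :=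
    FuzzyLaxExtension {
  lax :> forall A B : SET, fuzzy_rel R A B -> fuzzy_rel R (T A) (T B);
  lax_mono : forall (A B : SET) (r1 r2 : fuzzy_rel R A B),
    fuzzy_le r1 r2 -> fuzzy_le (lax r1) (lax r2);
  lax_comp : forall (A B C : SET) (r : fuzzy_rel R A B) (s : fuzzy_rel R B C),
    fuzzy_le (lax (fuzzy_comp r s)) (fuzzy_comp (lax r) (lax s));
  lax_graph : forall (A B : SET) (f : A -> B),
    fuzzy_le (lax (graph R f)) (graph R (fmap f));
  lax_graph_conv : forall (A B : SET) (f : A -> B),
    fuzzy_le (lax (fuzzy_conv (graph R f))) (fuzzy_conv (graph R (fmap f))) }.

Definition finitarily_separable (R : realType) (T : set_functor)
    (L : fuzzy_lax_extension R T) : Prop :=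
  forall (X : SET) (t : T X) (eps : R), 0 < eps ->
    exists2 s : T X, fin_part s &
      (L X X (diag R X) t s)%:num <= eps /\
      (L X X (diag R X) s t)%:num <= eps.

Record pred_lifting (R : realType) (T : set_functor) (n : nat) := PredLifting {
  plift :> forall X : SET, ('I_n -> X -> {i01 R}) -> T X -> {i01 R};
  plift_natural : forall (X Y : SET) (h : X -> Y) (f : 'I_n -> Y -> {i01 R})
    (t : T X), plift (fun i => f i \o h) t = plift f (fmap h t) }.

Section PredicateLiftings.
Variables (R : realType) (T : set_functor).

Definition monotone_lifting (n : nat) (lam : pred_lifting R T n) : Prop :=
  forall (X : SET) (f g : 'I_n -> X -> {i01 R}),
    (forall i x, f i x <= g i x) -> forall t, lam X f t <= lam X g t.

Definition nonexpansive_lifting (n : nat) (lam : pred_lifting R T n) : Prop :=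
  forall (X : SET) (f g : 'I_n -> X -> {i01 R}),
    supdist (lam X f) (lam X g) <= \big[Num.max/0]_(i < n) supdist (f i) (g i).

(* lam is a lifting "for L": it sends r-nonexpansive pairs to L r-nonexpansive
   pairs.  For all lam in Lam, this says that Kantorovich Lam r <= L r, without
   which formulae need not be sound for L-simulations: for T constant bool and
   L r = 0, the 0-ary lifting b |-> (if b then 1 else 0) is monotone,
   nonexpansive and separating, but distinguishes states at L-distance 0. *)
Definition lifting_for (L : fuzzy_lax_extension R T) (n : nat)
    (lam : pred_lifting R T n) : Prop :=
  forall (A B : SET) (r : fuzzy_rel R A B)
    (f : 'I_n -> A -> {i01 R}) (g : 'I_n -> B -> {i01 R}),
    (forall i, nonexp_pair r (f i) (g i)) ->
    nonexp_pair (L A B r) (lam A f) (lam B g).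

(* A set of predicate liftings, sorted by arity. *)
Definition lifting_set := forall n : nat, set (pred_lifting R T n).

Variable Lam : lifting_set.

Definition Kantorovich (A B : SET) (r : fuzzy_rel R A B) :
    fuzzy_rel R (T A) (T B) :=
  fun t1 t2 => supI [set z | exists (n : nat) (lam : pred_lifting R T n)
      (f : 'I_n -> A -> {i01 R}) (g : 'I_n -> B -> {i01 R}),
    [/\ Lam lam, forall i, nonexp_pair r (f i) (g i) &
        z = ominus (lam A f t1) (lam B g t2)]].

Definition separating (L : fuzzy_lax_extension R T) : Prop :=
  forall (A B : SET) (r : fuzzy_rel R A B), fuzzy_le (L A B r) (Kantorovich r).

Inductive formula : Type :=
| FConst of {i01 rat}
| FMinus of formula & {i01 rat}
| FPlus of formula & {i01 rat}
| FAnd of formula & formula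
| FOr of formula & formula
| FMod (n : nat) (lam : pred_lifting R T n) of Lam lam & ('I_n -> formula).

Fixpoint sem (A : SET) (alpha : A -> T A) (phi : formula) : A -> {i01 R} :=
  match phi with
  | FConst c => fun=> ratI R c
  | FMinus psi c => fun a => ominus (sem alpha psi a) (ratI R c)
  | FPlus psi c => fun a => oplus (sem alpha psi a) (ratI R c)
  | FAnd psi chi => fun a => Order.min (sem alpha psi a) (sem alpha chi a)
  | FOr psi chi => fun a => Order.max (sem alpha psi a) (sem alpha chi a)
  | FMod n lam _ psis => fun a => lam A (fun i => sem alpha (psis i)) (alpha a)
  end.

Definition logical_distance (A B : SET) (alpha : A -> T A) (beta : B -> T B) :
    fuzzy_rel R A B :=
  fun a b => supI (range (fun phi => ominus (sem alpha phi a) (sem beta phi b))).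

End PredicateLiftings.

Section BehaviouralDistance.
Variables (R : realType) (T : set_functor) (L : fuzzy_lax_extension R T).
Variables (A B : SET) (alpha : A -> T A) (beta : B -> T B).

Definition simulation (r : fuzzy_rel R A B) : Prop :=
  forall a b, L A B r (alpha a) (beta b) <= r a b.

Definition behavioural_distance : fuzzy_rel R A B :=
  fun a b => infI [set r a b | r in simulation].

End BehaviouralDistance.

(* Main.v *)
(** If [r] is a simulation, all formulae are [r]-nonexpansive, by induction;
hence the logical distance [d] is below every simulation.  Conversely [d] is
itself a simulation: as [L d <= Kantorovich d], it suffices to compare
[lam f (alpha a)] with [lam g (beta b)] for [d]-nonexpansive pairs [(f, g)].
By finitary separability [alpha a] and [beta b] are approximated by elements
supported on finite sets [Y] and [Z], where [lam] sees only the restrictions of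
[f] and [g].  Since [f - g <= d] on [Y * Z], a finite join of finite meets of
shifted formulae is above [f] on [Y] and below [g] on [Z], up to a small error.
*)

Require Import Defs.
From mathcomp Require Import all_boot all_order all_algebra.
From mathcomp Require Import interval_inference.
From mathcomp Require Import all_classical all_reals.
From mathcomp Require Import lra.

Set Implicit Arguments.
Unset Strict Implicit.
Unset Printing Implicit Defensive.

Import Order.TTheory GRing.Theory Num.Theory.
Local Open Scope classical_set_scope.
Local Open Scope ring_scope.

(** * Suprema, infima and rational approximation in the unit interval *)

Section UnitIntervalTheory.
Variable R : realType.
Implicit Types (x y : {i01 R}) (S : set {i01 R}).

Lemma i01_bounds x : 0 <= x%:num <= 1.
Proof. by apply/andP. Qed.

Lemma oplusE x y : (oplus x y)%:num = Num.min (x%:num + y%:num) 1.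
Proof. by []. Qed.

Lemma ominusE x y : (ominus x y)%:num = Num.max (x%:num - y%:num) 0.
Proof. by []. Qed.

Lemma supI_ub S x : S x -> x%:num <= (supI S)%:num.
Proof.
move=> Sx; apply: ub_le_sup; last by exists x.
by exists 1 => _ [y _ <-].
Qed.

Lemma supI_lub S (r : R) :
  0 <= r -> (forall x, S x -> x%:num <= r) -> (supI S)%:num <= r.
Proof.
move=> r0 Sr; have [S0|/set0P[x Sx]] := eqVneq S set0.
  by rewrite /= S0 image_set0 sup0.
by apply: ge_sup => [|_ [y Sy <-]]; [exists x%:num, x | exact: Sr].
Qed.

Lemma supI_adherent S (e : R) : 0 < e -> S !=set0 ->
  exists2 x, S x & (supI S)%:num - e < x%:num.
Proof.
move=> e0 [x Sx].
have [|_ [y Sy <-] ?] := @sup_adherent _ [set x%:num | x in S] e e0.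
  split; first by exists x%:num, x.
  by exists 1 => _ [y _ <-].
by exists y.
Qed.

Lemma infI_lb S x : S x -> (infI S)%:num <= x%:num.
Proof.
move=> Sx; apply: ge_inf; last by left; exists x.
by exists 0 => _ [[y _ <-]//|->//].
Qed.

Lemma infI_glb S x : (forall y, S y -> x%:num <= y%:num) ->
  x%:num <= (infI S)%:num.
Proof.
move=> xS; apply: lb_le_inf => [|_ [[y Sy <-]|->]//]; first by exists 1; right.
exact: xS.
Qed.

Lemma ratI_approx x (e : R) : 0 < e ->
  exists c : {i01 rat}, x%:num - e <= (ratI R c)%:num <= x%:num.
Proof.
(* The rational is sought strictly between [max (x - e) 0] and [x], an interval that is empty for
   [x = 0]. *)
move=> e0; have [x0|x0] := eqVneq x%:num 0.
  exists 0%:i01; have -> : (ratI R 0%:i01)%:num = 0 by exact: rmorph0.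
  by rewrite x0 lexx andbT; lra.
have {}x0 : 0 < x%:num by rewrite lt_def x0 /=.
have /andP[_ x1] := i01_bounds x.
have [|q] := @rat_in_itvoo R (Num.max (x%:num - e) 0) x%:num.
  by rewrite gt_max x0 andbT; lra.
rewrite in_itv /= gt_max => /andP[/andP[q1 q0] q2].
have q0' : 0 <= q by rewrite -(ler0q R) ltW.
have q1' : q <= 1 by rewrite -(ler_rat R) rmorph1; lra.
exists (Itv01 q0' q1'); rewrite /=; lra.
Qed.

End UnitIntervalTheory.

(** * The supremum norm *)

Section SupremumDistance.
Variables (R : realType) (X : SET).
Implicit Types f g : X -> {i01 R}.

Lemma le_supdist f g x : `|(f x)%:num - (g x)%:num| <= supdist f g.
Proof.
apply: ub_le_sup; last by exists x.
exists 1 => _ [y _ <-]; rewrite ler_norml.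
have := i01_bounds (f y); have := i01_bounds (g y); lra.
Qed.

Lemma supdist_le f g (e : R) : 0 <= e ->
  (forall x, `|(f x)%:num - (g x)%:num| <= e) -> supdist f g <= e.
Proof.
move=> e0 fge; have [[x]|X0] := pselect (exists x : X, True).
  by move=> _; apply: ge_sup => [|_ [y _ <-]//]; exists `|(f x)%:num - (g x)%:num|, x.
(* On an empty carrier the norm is [sup set0 = 0], which [0 <= e] covers. *)
rewrite /supdist; set S := (X in sup X); suff -> : S = set0 by rewrite sup0.
by rewrite -subset0 => z [y _ _]; apply: X0; exists y.
Qed.

End SupremumDistance.

(** * Error bounds for predicate liftings *)

Section Liftings.
Variables (R : realType) (T : set_functor).

Lemma nonexp_pair_diag (X : SET) (f : X -> {i01 R}) :
  nonexp_pair (diag R X) f f.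
Proof.
move=> x y; rewrite /diag /graph; case: ifPn => [/asboolP <-|_] /=.
  by rewrite subrr.
by have := i01_bounds (f x); have := i01_bounds (f y); lra.
Qed.

(** Bounds the cost of replacing an element of [T X] by its finitary approximant under [lam]. *)
Lemma lifting_for_diag (L : fuzzy_lax_extension R T) (n : nat)
    (lam : pred_lifting R T n) (X : SET) (f : 'I_n -> X -> {i01 R}) (s t : T X) :
  lifting_for L lam ->
  (lam X f s)%:num - (lam X f t)%:num <= (L X X (diag R X) s t)%:num.
Proof. by apply=> i; exact: nonexp_pair_diag. Qed.

Lemma nonexpansive_lifting_le (n : nat) (lam : pred_lifting R T n) (X : SET)
    (f g : 'I_n -> X -> {i01 R}) (e : R) (t : T X) :
  nonexpansive_lifting lam -> 0 <= e ->
  (forall i x, `|(f i x)%:num - (g i x)%:num| <= e) ->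
  `|(lam X f t)%:num - (lam X g t)%:num| <= e.
Proof.
move=> lam_nonexp e0 fge.
apply: le_trans (le_supdist _ _ t) _.
apply: le_trans (lam_nonexp X f g) _.
by apply: bigmax_le => // i _; exact: supdist_le.
Qed.

(** Nonexpansiveness needs a two-sided bound, but only a one-sided one is given. The join [h] of [f]
    and [g] lies above [f], where monotonicity applies, and within [e] of [g]. *)
Lemma lifting_le_add (n : nat) (lam : pred_lifting R T n) (X : SET)
    (f g : 'I_n -> X -> {i01 R}) (e : R) (t : T X) :
  monotone_lifting lam -> nonexpansive_lifting lam -> 0 <= e ->
  (forall i x, (f i x)%:num <= (g i x)%:num + e) ->
  (lam X f t)%:num <= (lam X g t)%:num + e.
Proof.
move=> lam_mono lam_nonexp e0 fge.
pose h i x := Num.max (f i x) (g i x).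
have fh : (lam X f t)%:num <= (lam X h t)%:num.
  by rewrite num_le; apply: lam_mono => i x; rewrite /h le_max lexx.
have : `|(lam X h t)%:num - (lam X g t)%:num| <= e.
  apply: nonexpansive_lifting_le => // i x; rewrite /h num_max ler_norml.
  by move: (fge i x); rewrite maxEle; case: ifPn; rewrite -?ltNge; lra.
rewrite ler_norml; lra.
Qed.

(** Naturality along the inclusion of [Y] turns both sides into liftings of the restrictions to
    [Y]. *)
Lemma lifting_fin_le_add (n : nat) (lam : pred_lifting R T n) (X : SET)
    (Y : set X) (f g : 'I_n -> X -> {i01 R}) (e : R)
    (s : T {x : X | Y x}) :
  monotone_lifting lam -> nonexpansive_lifting lam -> 0 <= e ->
  (forall i x, Y x -> (f i x)%:num <= (g i x)%:num + e) ->
  (lam X f (Defs.fmap (@proj1_sig X (fun x => Y x)) s))%:num <=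
  (lam X g (Defs.fmap (@proj1_sig X (fun x => Y x)) s))%:num + e.
Proof.
move=> lam_mono lam_nonexp e0 fge; rewrite -!plift_natural.
by apply: lifting_le_add => // i [x Yx]; exact: fge.
Qed.

End Liftings.

(** * Soundness of formulae and finite interpolation *)

Section Logic.
Variables (R : realType) (T : set_functor) (Lam : lifting_set R T).
Variables (A B : SET) (alpha : A -> T A) (beta : B -> T B).

Local Notation semA := (sem alpha).
Local Notation semB := (sem beta).
Local Notation d := (logical_distance Lam alpha beta).

Lemma sem_nonexp_logical (phi : formula Lam) :
  nonexp_pair d (semA phi) (semB phi).
Proof.
move=> a b; apply: (@le_trans _ _ (ominus (semA phi a) (semB phi b))%:num).
  by rewrite ominusE le_max lexx.
by apply: supI_ub; exists phi.
Qed.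

Lemma sem_nonexp_simulation (L : fuzzy_lax_extension R T) (r : fuzzy_rel R A B)
    (phi : formula Lam) :
  (forall (n : nat) (lam : pred_lifting R T n), Lam lam -> lifting_for L lam) ->
  simulation L alpha beta r -> nonexp_pair r (semA phi) (semB phi).
Proof.
move=> Lam_for_L sim; elim: phi => [c|phi IH c|phi IH c|phi IH1 psi IH2|
  phi IH1 psi IH2|n lam Lam_lam phis IH] a b.
- by rewrite subrr.
- have := IH a b; have := i01_bounds (r a b); rewrite !ominusE !maxEle.
  by do 2!(case: ifPn; rewrite -?ltNge => ?); lra.
- have := IH a b; have := i01_bounds (r a b); rewrite !oplusE !minEle.
  by do 2!(case: ifPn; rewrite -?ltNge => ?); lra.
- have := IH1 a b; have := IH2 a b; rewrite /= !num_min !minEle.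
  by do 2!(case: ifPn; rewrite -?ltNge => ?); lra.
- have := IH1 a b; have := IH2 a b; rewrite /= !num_max !maxEle.
  by do 2!(case: ifPn; rewrite -?ltNge => ?); lra.
(* The modal case: [lam] carries the [r]-nonexpansive arguments to an [L r]-nonexpansive pair, and
   the simulation condition returns from [L r] to [r]. *)
- apply: (@le_trans _ _ (L A B r (alpha a) (beta b))%:num); last exact: sim.
  by apply: (Lam_for_L _ _ Lam_lam) => i; exact: IH.
Qed.

(* A formula almost realising [d a b] is shifted down by about its value at
   [b], then up by about [y]. *)
Lemma interpolate_pair (a : A) (b : B) (x y : {i01 R}) (e : R) : 0 < e ->
  x%:num - y%:num <= (d a b)%:num ->
  exists phi : formula Lam,
    x%:num - 2 * e <= (semA phi a)%:num /\ (semB phi b)%:num <= y%:num + e.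
Proof.
move=> e0 xyd; have [xy|xy] := leP x%:num (y%:num + e).
  have [c c_approx] := ratI_approx x e0.
  by exists (FConst Lam c) => /=; move: c_approx; rewrite /=; lra.
have [|_ [psi _ <-]] := @supI_adherent _
    (range (fun psi : formula Lam => ominus (semA psi a) (semB psi b))) e e0.
  by exists (ominus (semA (FConst Lam 0%:i01) a) (semB (FConst Lam 0%:i01) b)), (FConst Lam 0%:i01).
have /andP[_ x1] := i01_bounds x.
rewrite -/(d a b) ominusE => d_approx.
(* Here [d a b >= x - y > e], so the truncation at 0 is not active. *)
have {}d_approx : (d a b)%:num - e < (semA psi a)%:num - (semB psi b)%:num.
  by move: d_approx; rewrite lt_max => /orP[//|]; lra.
have [c c_approx] := ratI_approx (semB psi b) e0.
have [c' c'_approx] := ratI_approx y e0.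
(* At [a], one [e] is lost in the choice of [psi] and one in rounding [y] to [c']; at [b], only
   rounding to [c] costs an [e]. *)
exists (FPlus (FMinus psi c) c').
rewrite [semA _ a]/= [semB _ b]/= !oplusE !ominusE.
split; last first.
  rewrite ge_min; apply/orP; left; rewrite -lerBrDr ge_max; lra.
rewrite le_min; apply/andP; split; last lra.
rewrite -lerBlDr le_max; apply/orP; left; lra.
Qed.

(** The empty meet is the constant 1, whence [x <= 1]. The bounds are plain reals, since shifting by
    an error may leave the unit interval. *)
Lemma finite_meet (a : A) (g : B -> R) (x : R) (Z : set B) :
  finite_set Z -> x <= 1 ->
  (forall b, Z b -> exists phi : formula Lam,
    x <= (semA phi a)%:num /\ (semB phi b)%:num <= g b) ->
  exists phi : formula Lam, x <= (semA phi a)%:num /\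
    forall b, Z b -> (semB phi b)%:num <= g b.
Proof.
move=> /(@finite_seqP {classic B})[s ->{Z}] x1.
elim: s => [_|b s IH sP].
  exists (FConst Lam 1%:i01); split=> //=.
  by rewrite rmorph1.
have [|phi [phia phis]] := IH.
  by move=> b' b's; apply: sP; rewrite /= inE; apply/orP; right.
have [|psi [psia psib]] := sP b; first by rewrite /= mem_head.
exists (FAnd psi phi); split=> [|b'].
  by rewrite /= num_min le_min psia.
rewrite /= inE num_min ge_min => /predU1P[->|/phis ->]; last by rewrite orbT.
by rewrite psib.
Qed.

(** Dually, the empty join is the constant 0, whence [0 <= g b]. *)
Lemma finite_join (f : A -> R) (g : B -> R) (Y : set A) (Z : set B) :
  finite_set Y -> (forall b, Z b -> 0 <= g b) ->
  (forall a, Y a -> exists phi : formula Lam, f a <= (semA phi a)%:num /\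
    forall b, Z b -> (semB phi b)%:num <= g b) ->
  exists phi : formula Lam,
    (forall a, Y a -> f a <= (semA phi a)%:num) /\
    forall b, Z b -> (semB phi b)%:num <= g b.
Proof.
move=> /(@finite_seqP {classic A})[s ->{Y}] g0.
elim: s => [_|a s IH sP].
  exists (FConst Lam 0%:i01); split=> //= b Zb.
  by rewrite rmorph0 g0.
have [|phi [phis phiZ]] := IH.
  by move=> a' a's; apply: sP; rewrite /= inE; apply/orP; right.
have [|psi [psia psiZ]] := sP a; first by rewrite /= mem_head.
exists (FOr psi phi); split=> [a'|b Zb].
  rewrite /= inE num_max le_max => /predU1P[->|/phis ->]; last by rewrite orbT.
  by rewrite psia.
by rewrite /= num_max ge_max psiZ ?phiZ.
Qed.

(** Meets and joins add no error, so the loss is that of a single pair, whatever the sizes of [Y]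
    and [Z]. *)
Lemma finite_interpolation (f : A -> {i01 R}) (g : B -> {i01 R})
    (Y : set A) (Z : set B) (e : R) :
  0 < e -> finite_set Y -> finite_set Z -> nonexp_pair d f g ->
  exists phi : formula Lam,
    (forall a, Y a -> (f a)%:num <= (semA phi a)%:num + 2 * e) /\
    forall b, Z b -> (semB phi b)%:num <= (g b)%:num + e.
Proof.
move=> e0 finY finZ fg.
have [b _||phi [phiY phiZ]] :=
    @finite_join (fun a => (f a)%:num - 2 * e) (fun b => (g b)%:num + e) Y Z finY.
- by rewrite addr_ge0 // ltW.
- move=> a _; apply: finite_meet => // [|b _]; last exact: interpolate_pair.
  by have := i01_bounds (f a); lra.
- by exists phi; split=> // a /phiY; lra.
Qed.

End Logic.

(** * The logical distance is a simulation *)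

Section Completeness.
Variables (R : realType) (T : set_functor).
Variables (L : fuzzy_lax_extension R T) (Lam : lifting_set R T).
Hypothesis L_fin_sep : finitarily_separable L.
Hypothesis Lam_mono : forall (n : nat) (lam : pred_lifting R T n),
  Lam lam -> monotone_lifting lam.
Hypothesis Lam_nonexp : forall (n : nat) (lam : pred_lifting R T n),
  Lam lam -> nonexpansive_lifting lam.
Hypothesis Lam_for_L : forall (n : nat) (lam : pred_lifting R T n),
  Lam lam -> lifting_for L lam.
Hypothesis Lam_sep : separating Lam L.
Variables (A B : SET) (alpha : A -> T A) (beta : B -> T B).

Local Notation d := (logical_distance Lam alpha beta).

Lemma logical_distance_simulation : simulation L alpha beta d.
Proof.
move=> a b; apply: (le_trans (Lam_sep d (alpha a) (beta b))).
rewrite -num_le; apply: supI_lub => // _ [n [lam [f [g [Lam_lam fg ->]]]]].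
rewrite ominusE ge_max ge0 andbT; apply/ler_addgt0Pr => e' e'0.
(* Four passages between [alpha a] and [s'] or [beta b] and [u'] cost [e] each; interpolation costs
   [2 * e] on [Y] and [e] on [Z]. *)
pose e := e' / 7; have e0 : 0 < e by rewrite divr_gt0.
have [s' [Y finY [s _ s's]] [ts' s't]] := L_fin_sep (alpha a) e0.
have [u' [Z finZ [u _ u'u]] [tu' u't]] := L_fin_sep (beta b) e0.
have /choice[phi phiP] i := finite_interpolation e0 finY finZ (fg i).
(* This formula links the two sides: its values at [a] and [b] are [lam] applied to the
   interpolants, and they differ by at most [d a b]. *)
pose psi := FMod Lam_lam phi.
have := sem_nonexp_logical alpha beta psi a b; rewrite [sem alpha _ _]/= [sem beta _ _]/=.
set F := fun i => sem alpha (phi i); set G := fun i => sem beta (phi i).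
have fs' : (lam A f s')%:num <= (lam A F s')%:num + 2 * e.
  rewrite -s's; apply: lifting_fin_le_add; [exact: Lam_mono|exact: Lam_nonexp| |].
    lra.
  by move=> i y Yy; case: (phiP i) => + _; exact.
have gu' : (lam B G u')%:num <= (lam B g u')%:num + e.
  rewrite -u'u; apply: lifting_fin_le_add; [exact: Lam_mono|exact: Lam_nonexp| |].
    lra.
  by move=> i z Zz; case: (phiP i) => _; exact.
have for_L := Lam_for_L Lam_lam.
have := lifting_for_diag f (alpha a) s' for_L.
have := lifting_for_diag F s' (alpha a) for_L.
have := lifting_for_diag g u' (beta b) for_L.
have := lifting_for_diag G (beta b) u' for_L.
have -> : e' = 7 * e by rewrite /e; lra.
move: e0 ts' s't tu' u't fs' gu'; clear; lra.
Qed.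

End Completeness.

Theorem theorem8p8 (R : realType) (T : set_functor)
    (L : fuzzy_lax_extension R T) (Lam : lifting_set R T)
    (L_fin_sep : finitarily_separable L)
    (Lam_mono : forall (n : nat) (lam : pred_lifting R T n),
      Lam n lam -> monotone_lifting lam)
    (Lam_nonexp : forall (n : nat) (lam : pred_lifting R T n),
      Lam n lam -> nonexpansive_lifting lam)
    (Lam_for_L : forall (n : nat) (lam : pred_lifting R T n),
      Lam n lam -> lifting_for L lam)
    (Lam_sep : separating Lam L)
    (A B : SET) (alpha : A -> T A) (beta : B -> T B) (a : A) (b : B) :
  logical_distance Lam alpha beta a b = behavioural_distance L alpha beta a b.
Proof.
apply/le_anti/andP; split; rewrite -num_le.
  apply: infI_glb => _ [r sim <-]; apply: supI_lub => // _ [phi _ <-].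
  rewrite ominusE ge_max ge0 andbT.
  exact: (sem_nonexp_simulation phi Lam_for_L sim).
apply: infI_lb; exists (logical_distance Lam alpha beta) => //.
exact: logical_distance_simulation.
Qed.
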